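(* Let $c>0$, $0<\lambda<T_M$, and let $f\in C^2(\mathbb R)$ solve $$f''(y)-cf'(y)-f^4(y)=-\int_{-\infty}^\infty E(y-\eta)f^4(\eta)\,d\eta\ (y\in\mathbb R),\qquad 0<\lambda\le f\le T_M.$$ Then there exists $\varepsilon_0=\varepsilon_0(T_M,\lambda,c)>0$ such that for every $\varepsilon<\varepsilon_0$ there exists $L_0=L_0(\varepsilon,T_M,\lambda,c)>0$ with the property that, for every $L>L_0$, if $\operatorname{osc}_{[-L,L]}f<\varepsilon$ then $\operatorname{osc}_{[L,\infty)}f<3\varepsilon$.
   Context: $E(x)=\frac12\int_{|x|}^\infty\frac{e^{-t}}{t}dt$. For $I\subseteq\mathbb R$, $\operatorname{osc}_I f=\sup_{y_1,y_2\in I}|f(y_1)-f(y_2)|$. *)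

(* Defs.v *)
From HB Require Import structures.
From mathcomp Require Import all_boot all_order all_algebra.
From mathcomp Require Import all_classical all_reals all_analysis.
Set Implicit Arguments. Unset Strict Implicit. Unset Printing Implicit Defensive.
Import Order.TTheory GRing.Theory Num.Theory.
Import numFieldNormedType.Exports.
Local Open Scope classical_set_scope.
Local Open Scope ring_scope.

(* E(x) = 1/2 int_{|x|}^oo e^{-t}/t dt, as an extended real (= +oo at x = 0). *)
Definition Ekernel (R : realType) (x : R) : \bar R :=
  ((2^-1)%:E * \int[@lebesgue_measure R]_(t in `[(`|x|)%R, +oo[%classic) (expR (- t) / t)%:E)%E.

Definition Econv (R : realType) (f : R -> R) (y : R) : \bar R :=
  (\int[@lebesgue_measure R]_(eta in [set: R]) (Ekernel (y - eta) * (f eta ^+ 4)%:E))%E.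

Definition osc (R : realType) (f : R -> R) (I : set R) : \bar R :=
  ereal_sup [set (`|f y.1 - f y.2|)%:E | y in I `*` I].

Definition C2 (R : realType) (f : R -> R) : Prop :=
  (forall x, derivable f x 1) /\ (forall x, derivable (derive1 f) x 1) /\
  continuous (derive1 (derive1 f)).

(* Main.v *)
Require Import Defs.
From HB Require Import structures.
From mathcomp Require Import all_boot all_order all_algebra.
From mathcomp Require Import all_classical all_reals all_analysis.
From mathcomp Require Import measurable_realfun ring lra.
Import Order.TTheory GRing.Theory Num.Theory.
Import numFieldNormedType.Exports.
Local Open Scope classical_set_scope.
Local Open Scope ring_scope.
Set Implicit Arguments. Unset Strict Implicit. Unset Printing Implicit Defensive.

(** Every solution is constant, so its oscillation vanishes.  Write g = f^4.
    Exchanging integrals, E * g (y) is the average against exp(-t) dt of the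
    means of g over [y - t, y + t].

    Both u = sup f - f and u = f - inf f are nonnegative and satisfy
    u'' - c u' <= a (a + c) u on the whole line for a large enough; factoring
    the operator yields - a u <= u' <= (a + c) u, a Harnack inequality, so f is
    nearly constant on long intervals around points where it is close to its
    supremum or its infimum.

    The right-hand side is the derivative of a bounded nonlocal flux Psi, hence
    f' - c f - Psi is a constant K.  At near-extremal points f' and Psi are
    small, so K = - c sup f = - c inf f, and c > 0 forces sup f = inf f. *)

(** * One-variable calculus and the Harnack inequality *)

Section calculus.
Context {R : realType}.
Implicit Types F : R -> R.

Lemma is_derive_continuous F (F' : R -> R) :
  (forall x : R, is_derive x (1 : R) F (F' x)) -> continuous F.
Proof.
by move=> dF x; apply/differentiable_continuous/derivable1_diffP; have [] := dF x.
Qed.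

Lemma continuous_exprn_comp F (n : nat) :
  continuous F -> continuous (fun x => F x ^+ n).
Proof.
move=> cF x; apply: (@continuous_comp _ _ _ F (fun z : R => z ^+ n) x).
  exact: cF.
exact: exprn_continuous.
Qed.

Lemma le_of_derive_le F (F' : R -> R) (a b C : R) : a <= b ->
  (forall x : R, is_derive x (1 : R) F (F' x)) ->
  (forall x, a <= x <= b -> F' x <= C) -> F b - F a <= C * (b - a).
Proof.
move=> ab dF hC; have [|x xab ->] := @MVT_segment R F F' a b ab.
- exact/continuous_subspaceT/(is_derive_continuous dF).
- by rewrite ler_wpM2r ?subr_ge0// hC//; move: xab; rewrite in_itv.
Qed.

Lemma normr_le_of_derive_le F (F' : R -> R) (a b C : R) : a <= b ->
  (forall x : R, is_derive x (1 : R) F (F' x)) ->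
  (forall x, a <= x <= b -> `|F' x| <= C) -> `|F b - F a| <= C * (b - a).
Proof.
move=> ab dF hC; have [|x xab ->] := @MVT_segment R F F' a b ab.
- exact/continuous_subspaceT/(is_derive_continuous dF).
- rewrite normrM (@ger0_norm _ (b - a)) ?subr_ge0//.
  by rewrite ler_wpM2r ?subr_ge0// hC//; move: xab; rewrite in_itv.
Qed.

Lemma is_derive_comp_affine F (F' : R -> R) (k y x : R) :
  (forall x : R, is_derive x (1 : R) F (F' x)) ->
  is_derive x (1 : R) (fun s => F (y + k * s)) (k * F' (y + k * x)).
Proof.
move=> dF; rewrite mulrC; apply: (@is_derive1_comp _ F (fun s => y + k * s)).
by apply: is_derive_eq; rewrite /GRing.scale/=; ring.
Qed.

(** Integrating factor: a sign for F' + k F becomes monotonicity of exp(k s) F(s). *)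
Lemma is_derive_weight F (F' : R -> R) (k x : R) :
  (forall x : R, is_derive x (1 : R) F (F' x)) ->
  is_derive x (1 : R) (fun s => expR (k * s) * F s) (expR (k * x) * (F' x + k * F x)).
Proof.
move=> dF.
have dE : is_derive x (1 : R) (fun s => expR (k * s)) (k * expR (k * x)).
  have := is_derive_comp_affine k 0 x (@is_derive_expR R).
  by under eq_fun do rewrite add0r; rewrite add0r.
have := dF x => dFx.
by apply: is_derive_eq; rewrite /GRing.scale/=; ring.
Qed.

Lemma exists_gt_mul (k C : R) : 0 < k -> exists s, 0 <= s /\ C < k * s.
Proof.
move=> k0; exists ((`|C| + 1) / k); split.
  by rewrite divr_ge0// ?ltW// addr_ge0.
by rewrite mulrCA divff ?gt_eqF// mulr1; have := ler_norm C; lra.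
Qed.

End calculus.

Section harnack.
Context {R : realType}.
Variables (c a : R) (u u1 u2 : R -> R).
Hypotheses (c0 : 0 < c) (a0 : 0 < a).
Let ac_ge0 : 0 <= a + c. Proof. by rewrite addr_ge0 ?ltW. Qed.
Hypothesis du : forall x, is_derive x (1 : R) u (u1 x).
Hypothesis du1 : forall x, is_derive x (1 : R) u1 (u2 x).
Hypothesis u_ge0 : forall x, 0 <= u x.
Hypothesis supersol : forall x, u2 x - c * u1 x <= a * (a + c) * u x.

(* The operator factors as (D + a)(D - (a + c)).  If u' + a u were negative
   somewhere, it would stay so to the right, and u would become negative. *)
Lemma supersol_derive_ge x : - a * u x <= u1 x.
Proof.
rewrite leNgt; apply/negP => h.
pose w s := u1 s + a * u s.
have w0 : w x < 0 by rewrite /w; lra.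
have dw s : is_derive s (1 : R) w (u2 s + a * u1 s).
  have := du s; have := du1 s => ? ?.
  by apply: is_derive_eq; rewrite /GRing.scale/=; ring.
have le_u1 s : x <= s -> u1 s <= w x.
  move=> xs.
  have hh t : x <= t <= s ->
    expR (- (a + c) * t) * (u2 t + a * u1 t + - (a + c) * w t) <= 0.
    move=> _; apply: mulr_ge0_le0; first exact: expR_ge0.
    by have := supersol t; rewrite /w; lra.
  have := le_of_derive_le (C := 0) xs (fun s => is_derive_weight (- (a + c)) s dw) hh.
  rewrite mul0r subr_le0 => hle.
  have : w s <= expR ((a + c) * (s - x)) * w x.
    rewrite -(ler_pM2l (expR_gt0 (- (a + c) * s))).
    rewrite mulrA -expRD.
    by rewrite (_ : _ * s + _ = - (a + c) * x); last ring.
  have : 1 <= expR ((a + c) * (s - x)).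
    by rewrite -[leLHS]expR0 ler_expR mulr_ge0 ?subr_ge0//.
  set E := expR _ => E1 wsE; have : E * w x <= w x by nra.
  by have := mulr_ge0 (ltW a0) (u_ge0 s); rewrite /w in wsE *; lra.
(* To the right of x the slope of u is at most [w x] < 0, so over a long enough stretch u loses more
   than [u x], against u >= 0. *)
have [s [s0 hs]] := exists_gt_mul (u x) (k := - w x) ltac:(lra).
have xs : x <= x + s by lra.
have := le_of_derive_le xs du (fun t ht => le_u1 t (proj1 (andP ht))).
by have := u_ge0 (x + s); lra.
Qed.

(** Mirror image, with the factors in the other order: w = u' - (a + c) u satisfies w' + a w <= 0,
    so a positive value of w persists to the left, u' stays above it there, and u becomes
    negative. *)
Lemma supersol_derive_le x : u1 x <= (a + c) * u x.
Proof.
rewrite leNgt; apply/negP => h.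
pose w s := u1 s - (a + c) * u s.
have w0 : 0 < w x by rewrite /w; lra.
have dw s : is_derive s (1 : R) w (u2 s - (a + c) * u1 s).
  have := du s; have := du1 s => ? ?.
  by apply: is_derive_eq; rewrite /GRing.scale/=; ring.
have ge_u1 s : s <= x -> w x <= u1 s.
  move=> sx.
  have hh t : s <= t <= x ->
    expR (a * t) * (u2 t - (a + c) * u1 t + a * w t) <= 0.
    move=> _; apply: mulr_ge0_le0; first exact: expR_ge0.
    by have := supersol t; rewrite /w; lra.
  have := le_of_derive_le (C := 0) sx (fun s => is_derive_weight a s dw) hh.
  rewrite mul0r subr_le0 => hle.
  have : expR (a * (x - s)) * w x <= w s.
    rewrite -(ler_pM2l (expR_gt0 (a * s))).
    rewrite mulrA -expRD.
    by rewrite (_ : a * s + _ = a * x); last ring.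
  have : 1 <= expR (a * (x - s)).
    by rewrite -[leLHS]expR0 ler_expR mulr_ge0 ?subr_ge0// ltW.
  set E := expR _ => E1 wsE; have : w x <= E * w x by nra.
  by have := mulr_ge0 ac_ge0 (u_ge0 s); rewrite /w in wsE *; lra.
have [s [s0 hs]] := exists_gt_mul (u x) w0.
have xs : x - s <= x by lra.
have dNu t : is_derive t (1 : R) (fun s => - u s) (- u1 t) by have := du t => ?; exact: is_deriveN.
have hh t : x - s <= t <= x -> - u1 t <= - w x.
  by move=> /andP[_ tx]; rewrite lerN2 ge_u1.
have := le_of_derive_le xs dNu hh.
by have := u_ge0 (x - s); lra.
Qed.

(** By the two derivative bounds exp(a x) u is nondecreasing and exp(-(a + c) x) u is nonincreasing;
    the larger rate a + c serves both directions. *)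
Lemma supersol_harnack x y : u x <= u y * expR ((a + c) * `|x - y|).
Proof.
have [xy|/ltW xy] := leP x y.
- have hh t : x <= t <= y -> - (expR (a * t) * (u1 t + a * u t)) <= 0.
    move=> _; rewrite oppr_le0; apply: mulr_ge0; first exact: expR_ge0.
    by have := supersol_derive_ge t; lra.
  have dN t : is_derive t (1 : R) (fun s => - (expR (a * s) * u s))
      (- (expR (a * t) * (u1 t + a * u t))).
    by have := is_derive_weight a t du => ?; exact: is_deriveN.
  have := le_of_derive_le xy dN hh; rewrite mul0r => hle.
  have {hle} : u x <= u y * expR (a * (y - x)).
    rewrite -(ler_pM2l (expR_gt0 (a * x))).
    rewrite mulrCA -expRD (_ : a * x + _ = a * y); last ring.
    by lra.
  move=> /le_trans; apply; rewrite ler_wpM2l// ler_expR.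
  by rewrite distrC ger0_norm ?subr_ge0// ler_wpM2r ?subr_ge0// lerDl ltW.
- have hh t : y <= t <= x -> expR (- (a + c) * t) * (u1 t + - (a + c) * u t) <= 0.
    move=> _; apply: mulr_ge0_le0; first exact: expR_ge0.
    by have := supersol_derive_le t; lra.
  have := le_of_derive_le xy (fun s => is_derive_weight (- (a + c)) s du) hh.
  rewrite mul0r => hle.
  rewrite ger0_norm ?subr_ge0//.
  rewrite -(ler_pM2l (expR_gt0 (- (a + c) * x))).
  rewrite [leRHS]mulrCA -expRD (_ : _ * x + _ = - (a + c) * y); last ring.
  by lra.
Qed.

End harnack.

(** * Primitives and exponentially weighted integrals *)

Section primitive.
Context {R : realType}.
Notation mu := (@lebesgue_measure R).

Lemma integrable_segment (g : R -> R) (a b : R) :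
  continuous g -> mu.-integrable `[a, b] (EFin \o g).
Proof.
move=> cg; apply: continuous_compact_integrable; first exact: segment_compact.
exact: continuous_subspaceT.
Qed.

Lemma exists_primitive (g : R -> R) : continuous g ->
  exists G : R -> R, forall x : R, is_derive x (1 : R) G (g x).
Proof.
move=> cg.
pose J (a b : R) := \int[mu]_(t in `[a, b]) g t.
(* [J a b] vanishes when b < a, the interval being empty, so the orientation for negative x is put
   in by hand. *)
pose G (x : R) := if 0 <= x then J 0 x else - J x 0.
have JD (a b d : R) : a <= b -> b <= d -> J a d = J a b + J b d.
  move=> ab bd; rewrite /J -[X in _ + X]Rintegral_itv_obnd_cbnd; last first.
    apply: (integrableS _ _ _ (@integrable_segment g b d cg)) => //.
    exact: subset_itv_oc_cc.
  rewrite -(@Rintegral_itvB _ g (BLeft a) (BRight d) b) ?bnd_simp//; first by ring.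
  exact: integrable_segment.
have GE (a x : R) : a <= 0 -> a <= x -> G x = J a x - J a 0.
  move=> a0 ax; rewrite /G; case: ifPn => [x0|]; first by rewrite (JD a 0 x)//; ring.
  by rewrite -ltNge => /ltW x0; rewrite (JD a x 0)//; ring.
exists G => x.
(* A base point to the left of both 0 and x: near x, G coincides with [J a s - J a 0], to which the
   fundamental theorem of calculus applies. *)
pose a := - `|x| - 1.
have ax : a < x by rewrite /a; have := ler_norm (- x); rewrite normrN; lra.
have a0 : a <= 0 by rewrite /a; have := normr_ge0 x; lra.
have [dF F'] := @continuous_FTC1_closed R g a x (x + 1) ltac:(lra)
  (@integrable_segment g a (x + 1) cg) ax (cg x).
have dJ : is_derive x (1 : R) (fun s => J a s - J a 0) (g x).
  have dJ0 : is_derive x (1 : R) (J a) (g x).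
    by split => //; rewrite -derive1E.
  by apply: is_derive_eq; rewrite subr0.
apply: near_eq_is_derive dJ.
near=> s; apply/esym/GE => //; apply/ltW; near: s.
exact: lt_nbhsr.
Unshelve. all: by end_near. Qed.

End primitive.

Section weighted_integral.
Context {R : realType}.
Notation mu := (@lebesgue_measure R).
Local Notation pos := (`]0, +oo[%classic : set R).
Implicit Types (C D : R) (phi psi : R -> R).

Lemma integral_expR_scaled (k : R) : 0 < k ->
  (\int[mu]_(t in pos) (expR (- (k * t)))%:E = (k^-1)%R%:E)%E.
Proof.
move=> k0.
have dE (x : R) : is_derive x (1 : R) (fun s : R => expR (- (k * s))) (- k * expR (- (k * x))).
  have := is_derive_comp_affine (- k) 0 x (@is_derive_expR R).
  by under eq_fun do rewrite add0r mulNr; rewrite add0r [in X in expR X]mulNr.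
have dF (x : R) : is_derive x (1 : R) (fun s : R => - k^-1 * expR (- (k * s))) (expR (- (k * x))).
  apply: is_derive_eq; rewrite /GRing.scale/=; field.
  by rewrite gt_eqF.
have cE := is_derive_continuous dE.
rewrite integral_itv_obnd_cbnd; last first.
  apply/measurable_EFinP; apply: measurable_funTS.
  by apply: continuous_measurable_fun; exact: cE.
pose F (s : R) := - k^-1 * expR (- (k * s)).
transitivity (0%:E - (F 0)%:E)%E; last first.
  by rewrite /F mulr0 oppr0 expR0 mulr1 sub0e EFinN oppeK.
apply: ge0_continuous_FTC2y.
- by move=> x _; exact: expR_ge0.
- exact/continuous_subspaceT/cE.
- rewrite -(mulr0 (- k^-1)); apply: cvgMr.
  have -> : (fun x : R => expR (- (k * x))) = (fun x : R => expR (- x)) \o (fun x => k * x) by [].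
  apply: (@cvg_comp _ _ _ _ _ _ (pinfty_nbhs R)); last exact: cvgr_expR.
  exact: gt0_cvgMry.
- by move=> x _; have [] := dF x.
- apply: cvg_at_right_filter; exact: (is_derive_continuous dF).
- by move=> x _; rewrite derive1E; have [_ ->] := dF x.
Qed.

(* [C * expR (t / 2)] is a convenient gauge: it dominates polynomials in t and
   stays integrable against the weight [expR (- t)]. *)
Definition gauged C phi :=
  measurable_fun pos phi /\ forall t, 0 < t -> `|phi t| <= C * expR (t / 2).

Definition wmean phi : R := \int[mu]_(t in pos) (expR (- t) * phi t).

Let integrable_half : mu.-integrable pos (EFin \o (fun t : R => expR (- (2^-1 * t)))).
Proof.
apply/integrableP; split.
  apply/measurable_EFinP; apply: measurable_funTS.
  apply: continuous_measurable_fun => x.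
  apply: continuous_comp; last exact: continuous_expR.
  by apply: continuousN; apply: continuousM; [exact: cst_continuous|exact: id].
under eq_integral do rewrite /= ger0_norm ?expR_ge0//.
by rewrite integral_expR_scaled// ltry.
Qed.

Lemma gauged_integrable C phi : gauged C phi ->
  mu.-integrable pos (EFin \o (fun t => expR (- t) * phi t)).
Proof.
move=> [mphi hC].
apply: (@le_integrable _ _ _ mu _ _ _
  (EFin \o (fun t : R => C * expR (- (2^-1 * t))))) => //.
- apply/measurable_EFinP; apply: measurable_funM => //; apply: measurable_funTS.
  by apply: measurableT_comp => //; exact: measurable_expR.
- move=> t; rewrite /= in_itv/= andbT => t0; rewrite lee_fin.
  apply: le_trans (ler_norm _); rewrite normrM ger0_norm ?expR_ge0//.
  rewrite (_ : - (2^-1 * t) = - t + t / 2); last by field.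
  by rewrite expRD mulrCA ler_wpM2l ?expR_ge0 ?hC.
- under [X in _.-integrable _ X]eq_fun do rewrite /= EFinM.
  exact: integrableZl.
Qed.

(** Against the gauge the weight leaves exp(- t / 2), whose integral over the half-line is 2. *)
Lemma wmean_norm_le C phi : gauged C phi -> `|wmean phi| <= 2 * C.
Proof.
move=> hphi; have [mphi hC] := hphi.
have iphi := gauged_integrable hphi.
apply: (le_trans (le_normr_Rintegral _ iphi)) => //.
have -> : 2 * C = \int[mu]_(t in pos) (C * expR (- (2^-1 * t))).
  rewrite RintegralZl//= /Rintegral integral_expR_scaled//= invrK.
  exact: mulrC.
apply: le_Rintegral => //.
- exact: (integrable_norm iphi).
- under [X in _.-integrable _ X]eq_fun do rewrite /= EFinM.
  exact: integrableZl.
- move=> t; rewrite /= in_itv/= andbT => t0; rewrite normrM ger0_norm ?expR_ge0//.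
  rewrite (_ : - (2^-1 * t) = - t + t / 2); last by field.
  by rewrite expRD mulrCA ler_wpM2l ?expR_ge0 ?hC.
Qed.

Lemma wmean_le C D phi psi : gauged C phi -> gauged D psi ->
  (forall t, 0 < t -> phi t <= psi t) -> wmean phi <= wmean psi.
Proof.
move=> hphi hpsi le; apply: le_Rintegral => //.
- exact: gauged_integrable hphi.
- exact: gauged_integrable hpsi.
- by move=> t; rewrite /= in_itv/= andbT => t0; rewrite ler_wpM2l ?expR_ge0 ?le.
Qed.

Lemma wmeanB C D phi psi : gauged C phi -> gauged D psi ->
  wmean (fun t => phi t - psi t) = wmean phi - wmean psi.
Proof.
move=> hphi hpsi; rewrite /wmean -RintegralB//.
- by apply: eq_Rintegral => t _; rewrite mulrBr.
- exact: gauged_integrable hphi.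
- exact: gauged_integrable hpsi.
Qed.

Lemma wmeanZ C k phi : gauged C phi -> wmean (fun t => k * phi t) = k * wmean phi.
Proof.
move=> hphi; rewrite /wmean -RintegralZl//; last exact: gauged_integrable hphi.
by apply: eq_Rintegral => t _; rewrite mulrCA.
Qed.

(** The weight has total mass 1, so [wmean] averages against a probability measure. *)
Lemma wmean_cst k : wmean (fun=> k) = k.
Proof.
have h := integral_expR_scaled (ltr01 : 0 < (1 : R)).
rewrite /wmean RintegralZr//.
  rewrite /Rintegral; under eq_integral do rewrite -[X in expR (- X)]mul1r.
  by rewrite h/= invr1 mul1r.
apply/integrableP; split.
  apply/measurable_EFinP; apply: measurable_funTS.
  by apply: measurableT_comp => //; exact: measurable_expR.
under eq_integral do rewrite /= ger0_norm ?expR_ge0// -[X in expR (- X)]mul1r.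
by rewrite h ltry.
Qed.

Lemma gauged_bounded C phi : measurable_fun pos phi ->
  (forall t, 0 < t -> `|phi t| <= C) -> gauged C phi.
Proof.
move=> mphi hC; split=> // t t0; apply: (le_trans (hC t t0)).
rewrite ler_peMr//; first exact: le_trans (normr_ge0 _) (hC t t0).
by rewrite -[leLHS]expR0 ler_expR; lra.
Qed.

Lemma gauged_cst (k : R) : gauged `|k| (fun=> k).
Proof. by apply: gauged_bounded => //; exact: measurable_cst. Qed.

Lemma gaugedB C D phi psi : gauged C phi -> gauged D psi ->
  gauged (C + D) (fun t => phi t - psi t).
Proof.
move=> [mphi hC] [mpsi hD]; split; first exact: measurable_funB.
move=> t t0; rewrite mulrDl (le_trans (ler_normB _ _))// lerD// ?hC ?hD//.
Qed.

Lemma gaugedZ C k phi : gauged C phi -> gauged (`|k| * C) (fun t => k * phi t).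
Proof.
move=> [mphi hC]; split; first by apply: measurable_funM => //; exact: measurable_cst.
by move=> t t0; rewrite normrM -mulrA ler_wpM2l// hC.
Qed.

End weighted_integral.

(** * The kernel as an average of interval means *)

Section tonelli.
Context {R : realType}.
Notation mu := (@lebesgue_measure R).
Local Notation pos := (`]0, +oo[%classic : set R).

Lemma measurable_inv_pos : measurable_fun pos (fun t : R => t^-1).
Proof.
apply: open_continuous_measurable_fun; first exact: interval_open.
move=> t; rewrite inE/= in_itv/= andbT => t0.
by apply: continuousV => //; rewrite gt_eqF.
Qed.

(* Exchanging the two integrals in [Econv] replaces the kernel by an
   exponential average over t of the means of [f ^+ 4] on [y - t, y + t]. *)
Lemma Econv_mean (f G : R -> R) (y : R) : continuous f ->
  (forall x : R, is_derive x (1 : R) G (f x ^+ 4)) ->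
  (Econv f y =
   \int[mu]_(t in pos) (expR (- t) * ((G (y + t) - G (y - t)) / (2 * t)))%:E)%E.
Proof.
move=> cf dG.
pose g (x : R) := f x ^+ 4.
have g_ge0 x : 0 <= g x by rewrite /g exprn_even_ge0.
have cg : continuous g := continuous_exprn_comp (n := 4) cf.
have mg : measurable_fun [set: R] g by exact: continuous_measurable_fun.
(* Half the kernel density, extended by 0 to t <= 0 so that both integrals run over the whole
   line. *)
pose om (t : R) := if 0 < t then expR (- t) / (2 * t) else 0.
have om_ge0 t : 0 <= om t.
  by rewrite /om; case: ifPn => // t0; rewrite divr_ge0 ?expR_ge0// mulr_ge0 ?ltW.
have mom : measurable_fun [set: R] om.
  apply: measurable_fun_if => //.
  - by apply: measurable_fun_ltr => //; exact: measurable_cst.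
  - rewrite setTI (_ : _ @^-1` _ = pos); last first.
      by apply/seteqP; split=> t /=; rewrite in_itv/= andbT.
    apply: measurable_funM.
      apply: measurable_funTS; apply: measurableT_comp => //.
    have -> : (fun t : R => (2 * t)^-1) = (fun t => 2^-1 * t^-1).
      by apply/funext => t; rewrite invfM.
    apply: measurable_funM; first exact: measurable_cst.
    exact: measurable_inv_pos.
(* Supported on the cone |y - eta| <= t: integrating in t first gives the kernel times g,
   integrating in eta first gives [om t] times the integral of g over [y - t, y + t]. *)
pose k (z : R * R) : \bar R := (if `|y - z.1| <= z.2 then om z.2 * g z.1 else 0)%:E.
have k_ge0 z : (0 <= k z)%E.
  by rewrite /k; case: ifPn => // _; rewrite lee_fin mulr_ge0.
have mk : measurable_fun [set: R * R] k.
  apply/measurable_EFinP; apply: measurable_fun_if => //.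
  - apply: measurable_fun_ler => //.
    apply: measurableT_comp => //; apply: measurable_funB => //.
  - apply: measurable_funTS; apply: measurable_funM.
    + by apply: measurableT_comp.
    + by apply: measurableT_comp.
transitivity (\int[mu]_eta \int[mu]_t k (eta, t))%E.
  apply: eq_integral => eta _; rewrite /Ekernel.
  have mI : measurable (`[`|y - eta|, +oo[%classic : set R) by [].
  have Eom : (\int[mu]_(t in `[(`|y - eta|)%R, +oo[) (expR (- t) / t)%:E =
      \int[mu]_(t in `[(`|y - eta|)%R, +oo[) (2 * om t)%:E)%E.
    apply: eq_integral => t; rewrite inE/= in_itv/= andbT => yt.
    (* The value t = 0 lies in the range only when eta = y; there both integrands are 0 because the
       inverse of 0 is 0. *)
    have /orP[/eqP<-|t0] : (0 == t) || (0 < t).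
      by rewrite -le_eqVlt (le_trans _ yt).
    - by rewrite /om ltxx invr0 !mulr0.
    - by rewrite /om t0; congr EFin; field; rewrite gt_eqF.
  rewrite Eom -ge0_integralZl//; last first.
  - by move=> t _; rewrite lee_fin mulr_ge0.
  - apply/measurable_EFinP; apply: measurable_funTS.
    by apply: measurable_funM => //; exact: measurable_cst.
  rewrite -ge0_integralZr//; last first.
  - by rewrite lee_fin g_ge0.
  - by move=> t _; rewrite lee_fin !mulr_ge0.
  - apply: measurable_funTS; apply/measurable_EFinP.
    by do 2 (apply: measurable_funM; first exact: measurable_cst).
  rewrite integral_mkcond; apply: eq_integral => t _.
  rewrite patchE /k/=; case: ifPn.
  - rewrite inE/= in_itv/= andbT => ->; congr EFin.
    by rewrite /g; field.
  - by rewrite notin_setE/= in_itv/= andbT => /negP/negbTE ->.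
transitivity (\int[mu]_t \int[mu]_eta k (eta, t))%E.
  exact: (@fubini_tonelli _ _ _ _ R mu mu k mk k_ge0).
rewrite [RHS]integral_mkcond.
apply: eq_integral => t _.
rewrite patchE; case: ifPn.
- rewrite inE/= in_itv/= andbT => t0.
  transitivity (\int[mu]_(eta in `[(y - t)%R, (y + t)%R]) ((om t)%:E * (g eta)%:E))%E.
    rewrite [RHS]integral_mkcond; apply: eq_integral => eta _.
    rewrite patchE /k/=; case: ifPn.
    + move=> h; rewrite ifT ?EFinM// inE/= in_itv/=.
      by move: h; rewrite ler_norml; lra.
    + move=> h; rewrite ifF//; apply/negbTE; rewrite notin_setE/= in_itv/=.
      by move=> h'; move/negP: h; apply; rewrite ler_norml; lra.
  rewrite ge0_integralZl//; last first.
  - by rewrite lee_fin om_ge0.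
  - by move=> eta _; rewrite lee_fin g_ge0.
  - by apply: measurable_funTS; apply/measurable_EFinP.
  rewrite (@continuous_FTC2 _ g G); last 4 first.
  - by lra.
  - exact: continuous_subspaceT.
  - split.
    + by move=> x _; have [] := dG x.
    + by apply: cvg_at_right_filter; exact: (is_derive_continuous dG).
    + by apply: cvg_at_left_filter; exact: (is_derive_continuous dG).
  - by move=> x _; rewrite derive1E; have [_ ->] := dG x.
  rewrite -EFinB -EFinM; congr EFin.
  by rewrite /om t0; ring.
- rewrite notin_setE/= in_itv/= andbT => /negP t0.
  apply: integral0_eq => eta _.
  by rewrite /k /= /om (negbTE t0) mul0r; case: ifP.
Qed.

End tonelli.

(** * Interval means *)

Section averages.
Context {R : realType}.
Local Notation pos := (`]0, +oo[%classic : set R).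
Implicit Types F : R -> R.

Lemma dist_le_of_derive_le_ball F (F' : R -> R) (y t C x : R) :
  (forall x : R, is_derive x (1 : R) F (F' x)) ->
  (forall z, `|z - y| <= t -> `|F' z| <= C) ->
  `|x - y| <= t -> `|F x - F y| <= C * `|x - y|.
Proof.
move=> dF hC xyt; have [xy|/ltW xy] := leP y x.
- rewrite (@ger0_norm _ (x - y)) ?subr_ge0//.
  apply: normr_le_of_derive_le (dF) _ => // z zxy; apply: hC.
  by move: xyt; rewrite !ler_norml; lra.
- rewrite distrC [X in _ * X]distrC (@ger0_norm _ (y - x)) ?subr_ge0//.
  apply: normr_le_of_derive_le (dF) _ => // z zxy; apply: hC.
  by move: xyt; rewrite !ler_norml; lra.
Qed.

(** The difference quotient is within K |h| of l. For the flux this stands in for differentiation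
    under the integral sign. *)
Lemma is_derive_of_quadratic_error F (y l K : R) :
  (forall h, `|F (y + h) - F y - h * l| <= K * h ^+ 2) ->
  is_derive y (1 : R) F l.
Proof.
move=> hK.
have K0 : 0 <= K by have := le_trans (normr_ge0 _) (hK 1); rewrite expr1n mulr1.
have cv : (fun h : R => h^-1 *: (F (h *: (1 : R) + y) - F y)) @ 0^' --> l.
  apply/cvgrPdist_le => e e0.
  near=> h.
  have h0 : h != 0 by near: h; exact: nbhs_dnbhs_neq.
  rewrite /GRing.scale/= mulr1 (addrC h y).
  rewrite (_ : l - _ = - (h^-1 * (F (y + h) - F y - h * l))); last first.
    by field.
  rewrite normrN normrM normfV ler_pdivrMl ?normr_gt0//.
  apply: le_trans (hK h) _.
  rewrite -normr_id -real_normK ?num_real// !normr_id expr2 mulrCA ler_wpM2l//.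
  (* Dividing by K + 1 covers the case K = 0. *)
  have : `|h| <= e / (K + 1).
    near: h; apply: dnbhs0_le; rewrite divr_gt0//; lra.
  rewrite ler_pdivlMr; last by lra.
  by have := normr_ge0 h; nra.
split; first by apply/cvg_ex; exists l.
exact: cvg_lim.
Unshelve. all: by end_near. Qed.

(** When F is a primitive of g, this is the mean of g over [y - t, y + t]. *)
Definition avg F (y t : R) := (F (y + t) - F (y - t)) / (2 * t).

Lemma avg_ge F (F' : R -> R) (y t m : R) : 0 < t ->
  (forall x : R, is_derive x (1 : R) F (F' x)) ->
  (forall x, m <= F' x) -> m <= avg F y t.
Proof.
move=> t0 dF hm.
have dN (x : R) : is_derive x (1 : R) (fun s => - F s) (- F' x).
  by have := dF x => ?; exact: is_deriveN.
have := @le_of_derive_le R _ _ (y - t) (y + t) (- m) _ dN.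
rewrite /avg ler_pdivlMr; last by lra.
have h1 : y - t <= y + t by lra.
have h2 x : y - t <= x <= y + t -> - F' x <= - m by move=> _; rewrite lerN2.
by move=> /(_ h1 h2); lra.
Qed.

Lemma avg_le F (F' : R -> R) (y t M : R) : 0 < t ->
  (forall x : R, is_derive x (1 : R) F (F' x)) ->
  (forall x, F' x <= M) -> avg F y t <= M.
Proof.
move=> t0 dF hM.
rewrite /avg ler_pdivrMr; last by lra.
have h1 : y - t <= y + t by lra.
have h2 x : y - t <= x <= y + t -> F' x <= M by move=> _.
have := le_of_derive_le h1 dF h2; lra.
Qed.

Lemma is_derive_shift F (F' : R -> R) (r x : R) :
  (forall x : R, is_derive x (1 : R) F (F' x)) ->
  is_derive x (1 : R) (fun s => F (s + r)) (F' (x + r)).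
Proof.
move=> dF; have := is_derive_comp_affine 1 r x dF.
by under eq_fun do rewrite mul1r addrC; rewrite !mul1r addrC.
Qed.

Lemma is_derive_avg F (F' : R -> R) (t y : R) :
  (forall x : R, is_derive x (1 : R) F (F' x)) ->
  is_derive y (1 : R) (fun s => avg F s t) (avg F' y t).
Proof.
move=> dF; have := is_derive_shift t y dF; have := is_derive_shift (- t) y dF.
move=> d1 d2; rewrite /avg; under eq_fun do rewrite mulrC.
by apply: is_derive_eq; rewrite /GRing.scale/=; ring.
Qed.

(** The difference of the two averages is the mean over [- t, t] of F'(s + x) - F'(s + y), so the
    constant does not depend on t. *)
Lemma avg_lipschitz F (F' : R -> R) (t x y L : R) : 0 < t ->
  (forall x : R, is_derive x (1 : R) F (F' x)) ->
  (forall x y, `|F' x - F' y| <= L * `|x - y|) ->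
  `|avg F x t - avg F y t| <= L * `|x - y|.
Proof.
move=> t0 dF hL.
have dD (s : R) : is_derive s (1 : R) (fun s => F (s + x) - F (s + y))
    (F' (s + x) - F' (s + y)).
  have := is_derive_shift x s dF; have := is_derive_shift y s dF => ? ?.
  exact: is_deriveB.
have h1 : - t <= t by lra.
have h2 s : - t <= s <= t -> `|F' (s + x) - F' (s + y)| <= L * `|x - y|.
  move=> _; apply: le_trans (hL _ _) _.
  by rewrite (_ : s + x - (s + y) = x - y)//; ring.
have := normr_le_of_derive_le h1 dD h2.
rewrite /avg (_ : _ / _ - _ =
  (F (t + x) - F (t + y) - (F (- t + x) - F (- t + y))) / (2 * t)); last first.
  by rewrite (addrC t x) (addrC t y) (addrC (- t) x) (addrC (- t) y); ring.
rewrite normrM normfV (@ger0_norm _ (2 * t)); last by lra.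
by rewrite ler_pdivrMr; lra.
Qed.

Lemma measurable_avg F (y : R) : continuous F -> measurable_fun pos (avg F y).
Proof.
move=> cF; apply: measurable_funM; last first.
  have -> : (fun t : R => (2 * t)^-1) = (fun t => 2^-1 * t^-1).
    by apply/funext => t; rewrite invfM.
  by apply: measurable_funM; [exact: measurable_cst|exact: measurable_inv_pos].
have mF : measurable_fun [set: R] F by exact: continuous_measurable_fun.
apply: measurable_funTS; apply: measurable_funB; apply: measurableT_comp => //.
- by apply: measurable_funD => //; exact: measurable_cst.
- by apply: measurable_funB => //; exact: measurable_cst.
Qed.

(** A symmetric mean reproduces affine functions at the centre. Removing the slope k from G leaves a
    function of slope at most e, which stays within e t of its central value. *)
Lemma avg_primitive_near (g G H : R -> R) (y t k e : R) : 0 < t ->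
  (forall x : R, is_derive x (1 : R) G (g x)) ->
  (forall x : R, is_derive x (1 : R) H (G x)) ->
  (forall x, `|x - y| <= t -> `|g x - k| <= e) ->
  `|G y - avg H y t| <= e * t.
Proof.
move=> t0 dG dH hg.
have e0 : 0 <= e.
  by apply: le_trans (normr_ge0 _) (hg y _); rewrite subrr normr0 ltW.
pose G0 x := G x - k * x.
have dG0 (x : R) : is_derive x (1 : R) G0 (g x - k).
  by have := dG x => ?; apply: is_derive_eq; rewrite /GRing.scale/=; ring.
(* The quadratic term takes the same value at y - t and y + t, so it cancels in the increment of
   [H0]. *)
pose H0 x := H x - G y * x - k * ((x - y) ^+ 2 / 2).
have dH0 (x : R) : is_derive x (1 : R) H0 (G0 x - G0 y).
  have := dH x => ?; apply: is_derive_eq; rewrite /GRing.scale/= /G0.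
  by field.
have h1 : y - t <= y + t by lra.
have h2 s : y - t <= s <= y + t -> `|G0 s - G0 y| <= e * t.
  move=> hs; have sy : `|s - y| <= t by rewrite ler_norml; lra.
  apply: le_trans (dist_le_of_derive_le_ball dG0 hg sy) _.
  by rewrite ler_wpM2l.
have := normr_le_of_derive_le h1 dH0 h2.
rewrite (_ : H0 _ - _ = - ((G y - avg H y t) * (2 * t))); last first.
  by rewrite /H0 /avg; field; rewrite gt_eqF.
rewrite normrN normrM (@ger0_norm _ (2 * t)); last by lra.
rewrite (_ : y + t - _ = 2 * t); last by ring.
by rewrite ler_pM2r//; lra.
Qed.

Lemma ler_id_expR_half (t : R) : t <= 2 * expR (t / 2).
Proof. by have := expR_ge1Dx (t / 2); lra. Qed.

Lemma ler_sqr_expR_half (t : R) : 0 < t -> t ^+ 2 <= 8 * expR (t / 2).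
Proof.
move=> t0; have := @expR_ge1Dxn R (t / 2) 1 ltac:(lra).
by rewrite (_ : (2`!)%:R = 2 :> R)// exprMn; lra.
Qed.

End averages.

(** * The flux and the Liouville theorem *)

Section flux.
Context {R : realType}.
Variables (B L : R) (g G H : R -> R).
Hypothesis dG : forall x : R, is_derive x (1 : R) G (g x).
Hypothesis dH : forall x : R, is_derive x (1 : R) H (G x).
Hypothesis g_itv : forall x, 0 <= g x <= B.
Hypothesis g_lipschitz : forall x y, `|g x - g y| <= L * `|x - y|.

(** For g = f^4 this is g minus its convolution with E, hence the value of f'' - c f'. *)
Definition source y := wmean (fun t => g y - avg G y t).
(** The source one integration higher. It is bounded even if G is not, since G and the means of G
    nearly cancel. *)
Definition flux y := wmean (fun t => G y - avg H y t).

Let B_ge0 : 0 <= B.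
Proof. by have /andP[] := g_itv 0; exact: le_trans. Qed.

Lemma avg_itv y t : 0 < t -> 0 <= avg G y t <= B.
Proof.
move=> t0; apply/andP; split.
- by apply: (avg_ge _ t0 dG) => x; have /andP[] := g_itv x.
- by apply: (avg_le _ t0 dG) => x; have /andP[] := g_itv x.
Qed.

Lemma gauged_avg y : gauged B (avg G y).
Proof.
apply: gauged_bounded; first by apply: measurable_avg; exact: (is_derive_continuous dG).
by move=> t t0; have := avg_itv y t0; rewrite ler_norml; lra.
Qed.

Lemma gauged_source y : gauged (`|g y| + B) (fun t => g y - avg G y t).
Proof. exact: gaugedB (gauged_cst _) (gauged_avg y). Qed.

Lemma sourceE y : source y = g y - wmean (avg G y).
Proof. by rewrite /source (wmeanB (gauged_cst _) (gauged_avg y)) wmean_cst. Qed.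

Lemma source_ge y m : (forall x, g x <= m) -> g y - m <= source y.
Proof.
move=> hm; rewrite -(wmean_cst (g y - m)).
apply: (wmean_le (gauged_cst _) (gauged_source y)) => t t0.
by rewrite lerD2l lerN2; exact: (avg_le _ t0 dG).
Qed.

Lemma source_le y m : (forall x, m <= g x) -> source y <= g y - m.
Proof.
move=> hm; rewrite -(wmean_cst (g y - m)).
apply: (wmean_le (gauged_source y) (gauged_cst _)) => t t0.
by rewrite lerD2l lerN2; exact: (avg_ge _ t0 dG).
Qed.

Lemma measurable_flux y :
  measurable_fun (`]0, +oo[%classic : set R) (fun t => G y - avg H y t).
Proof.
apply: measurable_funB; first exact: measurable_cst.
by apply: measurable_avg; exact: (is_derive_continuous dH).
Qed.

Lemma gauged_flux y : gauged (2 * B) (fun t => G y - avg H y t).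
Proof.
split; first exact: measurable_flux.
move=> t t0.
have hB x : `|x - y| <= t -> `|g x - 0| <= B.
  by move=> _; rewrite subr0; have := g_itv x; rewrite ler_norml; lra.
apply: le_trans (avg_primitive_near t0 dG dH hB) _.
by have := ler_id_expR_half t; have := B_ge0; nra.
Qed.

(** For each t the integrand g - [avg G] is 2 L-Lipschitz in y, so the first-order remainder of the
    flux integrand is at most 2 L h^2 uniformly in t; [wmean_norm_le] supplies the other factor
    2. *)
Lemma is_derive_flux (y : R) : is_derive y (1 : R) flux (source y).
Proof.
apply: (@is_derive_of_quadratic_error _ _ _ _ (2 * (2 * L))) => h.
rewrite /flux /source -(wmeanB (gauged_flux _) (gauged_flux _)).
rewrite -(wmeanZ h (gauged_source y)).
rewrite -(wmeanB (gaugedB (gauged_flux (y + h)) (gauged_flux y))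
                 (gaugedZ h (gauged_source y))).
rewrite -mulrA; apply: wmean_norm_le; apply: gauged_bounded.
  apply: measurable_funB; first by apply: measurable_funB; exact: measurable_flux.
  by have [] := gaugedZ h (gauged_source y).
move=> t t0.
pose p x := g x - avg G x t.
(* With the linear part at y removed, the increment of [P] is exactly the first-order remainder. *)
pose P x := G x - avg H x t - p y * x.
have dP (x : R) : is_derive x (1 : R) P (p x - p y).
  have := dG x; have := is_derive_avg t x dH => ? ?.
  by apply: is_derive_eq; rewrite /GRing.scale/= /p; ring.
have hp z : `|z - y| <= `|h| -> `|p z - p y| <= 2 * L * `|h|.
  move=> hz; rewrite (_ : p z - p y = (g z - g y) - (avg G z t - avg G y t)); last first.
    by rewrite /p; ring.
  apply: le_trans (ler_normB _ _) _.
  have := g_lipschitz z y; have := avg_lipschitz z y t0 dG g_lipschitz.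
  have L0 : 0 <= L.
    have := le_trans (normr_ge0 _) (g_lipschitz 1 0).
    by rewrite subr0 normr1 mulr1.
  by nra.
have hh : `|y + h - y| <= `|h| by rewrite addrC addKr.
have := dist_le_of_derive_le_ball dP hp hh.
rewrite (_ : y + h - y = h); last by ring.
rewrite -mulrA -expr2 real_normK ?num_real//.
rewrite (_ : P _ - P _ = G (y + h) - avg H (y + h) t - (G y - avg H y t)
  - h * (g y - avg G y t)) //.
by rewrite /P /p; ring.
Qed.

(* Splitting the average at t = S: below S use [e], above S use the crude
   bound B <= B * t / S. *)
Lemma flux_small (y k e S : R) : 0 < S -> 0 <= k <= B -> 0 <= e ->
  (forall x, `|x - y| <= S -> `|g x - k| <= e) ->
  `|flux y| <= 4 * e + 16 * B / S.
Proof.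
move=> S0 kB e0 he.
(* The integrand is at most e t + (B / S) t^2, and the gauge costs a factor 2 for t and 8 for
   t^2. *)
rewrite (_ : 4 * e + _ = 2 * (2 * e + 8 * (B / S))); last by ring.
apply: wmean_norm_le; split; first exact: measurable_flux.
move=> t t0.
have BS0 : 0 <= B / S by rewrite divr_ge0// ltW.
have E0 := expR_gt0 (t / 2).
have : `|G y - avg H y t| <= (e + B / S * t) * t.
  apply: (@avg_primitive_near _ g G H y t k) => // x xt.
  have [tS|St] := leP t S.
    by apply: le_trans (he x (le_trans xt tS)) _; rewrite lerDl mulr_ge0// ltW.
  have : `|g x - k| <= B by have := g_itv x; rewrite ler_norml; lra.
  move=> /le_trans; apply.
  have : B <= B / S * t.
    by rewrite mulrAC ler_pdivlMr// ler_wpM2l// ltW.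
  by lra.
move=> /le_trans; apply.
have := ler_id_expR_half t; have := ler_sqr_expR_half t0.
by rewrite expr2; nra.
Qed.

End flux.

Lemma le_factored_rate {R : realType} (A c : R) :
  0 <= A -> 0 < c -> A <= (A + 1) * (A + 1 + c).
Proof. by move=> A0 c0; nra. Qed.

Section liouville.
Context {R : realType}.
Variables (c T : R) (f f1 f2 G H : R -> R).
Hypothesis c0 : 0 < c.
Hypothesis df : forall x : R, is_derive x (1 : R) f (f1 x).
Hypothesis df1 : forall x : R, is_derive x (1 : R) f1 (f2 x).
Hypothesis f_itv : forall x, 0 <= f x <= T.
Let g x := f x ^+ 4.
Hypothesis dG : forall x : R, is_derive x (1 : R) G (g x).
Hypothesis dH : forall x : R, is_derive x (1 : R) H (G x).
Hypothesis f_eq : forall x, f2 x - c * f1 x = source g G x.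

(** [A] is a Lipschitz constant of the fourth power on [0, T]; [a] is chosen positive, even for T =
    0, with a (a + c) >= A. *)
Let A := 4 * T ^+ 3.
Let a := A + 1.

Let T_ge0 : 0 <= T.
Proof. by have /andP[] := f_itv 0; exact: le_trans. Qed.

Let A_ge0 : 0 <= A. Proof. by rewrite /A mulr_ge0// exprn_ge0. Qed.
Let a_gt0 : 0 < a. Proof. by rewrite /a ltr_wpDl. Qed.

Lemma pow4_sub_le (x y : R) : 0 <= x -> x <= y -> y <= T -> y ^+ 4 - x ^+ 4 <= A * (y - x).
Proof.
move=> x0 xy yT.
rewrite (_ : _ - _ = (y ^+ 3 + y ^+ 2 * x + y * x ^+ 2 + x ^+ 3) * (y - x)); last by ring.
rewrite ler_wpM2r ?subr_ge0//.
have y0 : 0 <= y by exact: le_trans xy.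
have xT : x <= T by exact: le_trans yT.
have -> : A = T ^+ 3 + T ^+ 2 * T + T * T ^+ 2 + T ^+ 3 by rewrite /A; ring.
have e n (z : R) : 0 <= z -> z <= T -> z ^+ n <= T ^+ n.
  by move=> z0 zT; apply: lerXn2r; rewrite ?nnegrE.
apply: lerD (e _ _ x0 xT); apply: lerD; last first.
  by apply: ler_pM => //; [exact: exprn_ge0|exact: e].
apply: lerD (e _ _ y0 yT) _.
by apply: ler_pM => //; [exact: exprn_ge0|exact: e].
Qed.

Lemma pow4_itv x : 0 <= g x <= T ^+ 4.
Proof.
have /andP[f0 fT] := f_itv x.
by rewrite /g exprn_ge0//= lerXn2r ?nnegrE.
Qed.

Section extremal_level.
Variables (s M : R).
Hypothesis s_sign : s = 1 \/ s = -1.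
Hypothesis M_itv : 0 <= M <= T.
Hypothesis M_extremal : forall x, 0 <= s * (M - f x).

(** Distance to the level M: s = 1 when M bounds f from above, s = -1 when from below, so one
    argument treats both ends. *)
Let u x := s * (M - f x).

Let du (x : R) : is_derive x (1 : R) u (- s * f1 x).
Proof. by have := df x => ?; apply: is_derive_eq; rewrite /GRing.scale/=; ring. Qed.

Let du1 (x : R) : is_derive x (1 : R) (fun x => - s * f1 x) (- s * f2 x).
Proof. by have := df1 x => ?; apply: is_derive_eq; rewrite /GRing.scale/=; ring. Qed.

Let dist_g x : `|g x - M ^+ 4| <= A * u x.
Proof.
have /andP[f0 fT] := f_itv x; have /andP[M0 MT] := M_itv.
have := M_extremal x; rewrite /u /g; case: s_sign => ->; rewrite ?mul1r ?mulN1r => h.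
- rewrite distrC ger0_norm; first by apply: pow4_sub_le => //; lra.
  by rewrite subr_ge0 lerXn2r ?nnegrE//; lra.
- rewrite ger0_norm; first by rewrite opprB; apply: pow4_sub_le => //; lra.
  by rewrite subr_ge0 lerXn2r ?nnegrE//; lra.
Qed.

(** All means of g lie on the same side of M^4 as g itself, so - s times the source is at most |g -
    M^4| <= A u. *)
Let supersol x : - s * f2 x - c * (- s * f1 x) <= a * (a + c) * u x.
Proof.
rewrite (_ : _ - _ = - s * source g G x); last by rewrite -f_eq; ring.
have : - s * source g G x <= s * (M ^+ 4 - g x).
  have /andP[M0 MT] := M_itv.
  have [h1|h1] := s_sign; rewrite h1.
  - have : g x - M ^+ 4 <= source g G x.
      apply: (source_ge dG pow4_itv) => z; have := M_extremal z; rewrite h1 mul1r => hz.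
      have /andP[f0 _] := f_itv z.
      by rewrite /g lerXn2r ?nnegrE//; lra.
    by lra.
  - have : source g G x <= g x - M ^+ 4.
      apply: (source_le dG pow4_itv) => z; have := M_extremal z; rewrite h1 mulN1r => hz.
      have /andP[f0 _] := f_itv z.
      by rewrite /g lerXn2r ?nnegrE//; lra.
    by lra.
move=> /le_trans; apply.
have : s * (M ^+ 4 - g x) <= A * u x.
  apply: le_trans (dist_g x); rewrite distrC -[leRHS]mul1r.
  have -> : 1 = `|s| by case: s_sign => ->; rewrite ?normrN normr1.
  by rewrite -normrM ler_norm.
move=> /le_trans; apply; apply: ler_wpM2r; [exact: M_extremal|rewrite /a].
exact: le_factored_rate.
Qed.

Lemma derive_le_level x : `|f1 x| <= (a + c) * u x.
Proof.
have := supersol_derive_ge c0 a_gt0 du du1 M_extremal supersol x.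
have := supersol_derive_le c0 a_gt0 du du1 M_extremal supersol x.
have -> : `|f1 x| = `|- s * f1 x|.
  by rewrite normrM normrN; case: s_sign => ->; rewrite ?normrN normr1 mul1r.
have := mulr_ge0 (ltW c0) (M_extremal x).
by rewrite ler_norml /u; lra.
Qed.

(** Harnack spreads the smallness of [u y] over the radius S at the price of an exponential
    factor. *)
Lemma flux_le_level y S : 0 < S ->
  `|flux G H y| <= 4 * (A * (u y * expR ((a + c) * S))) + 16 * T ^+ 4 / S.
Proof.
move=> S0; have /andP[M0 MT] := M_itv.
apply: (flux_small dG dH pow4_itv S0 (k := M ^+ 4)).
- by rewrite exprn_ge0//= lerXn2r ?nnegrE.
- apply: mulr_ge0 => //; apply: mulr_ge0; last exact: expR_ge0.
  exact: M_extremal.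
move=> x xS; apply: le_trans (dist_g x) _; rewrite ler_wpM2l//.
apply: le_trans (supersol_harnack c0 a_gt0 du du1 M_extremal supersol x y) _.
apply: ler_wpM2l; first exact: M_extremal.
by rewrite ler_expR ler_wpM2l// addr_ge0// ltW.
Qed.

(** Where u is small, f' and c (M - f) are small too. The radius S is fixed first to control the
    tail of the flux; only then is y chosen, close enough to the level to absorb the exponential in
    S. *)
Lemma conserved_at_level K : (forall x, f1 x - c * f x - flux G H x = K) ->
  (forall d, 0 < d -> exists y, s * (M - f y) < d) -> K = - c * M.
Proof.
move=> hK hinf; apply/eqP; rewrite -subr_eq0 -normr_le0 leNgt; apply/negP => X0.
set X := `|_| in X0.
have T4 : 0 <= T ^+ 4 by rewrite exprn_ge0.
(* Makes the tail 16 T^4 / S at most X / 2; adding 1 keeps S positive when T = 0. *)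
pose S := 32 * (T ^+ 4 + 1) / X.
have S0 : 0 < S by rewrite divr_gt0//; lra.
have hS : 16 * T ^+ 4 / S <= X / 2.
  rewrite ler_pdivrMr// /S; rewrite (_ : X / 2 * _ = 16 * (T ^+ 4 + 1)); first by lra.
  by field; rewrite gt_eqF.
(* The coefficients of [u y] coming from f', from c (M - f) and from the flux, in this order. *)
pose Q := (a + c) + c + 4 * A * expR ((a + c) * S).
have Q0 : 0 < Q.
  apply: ltr_pwDl; first by apply: addr_gt0 => //; exact: addr_gt0.
  by rewrite mulr_ge0 ?expR_ge0// mulr_ge0.
have [y hy] := hinf (X / (2 * Q)) ltac:(rewrite divr_gt0//; lra).
have : X <= Q * u y + 16 * T ^+ 4 / S.
  rewrite /X -(hK y).
  have -> : f1 y - c * f y - flux G H y - - c * M = f1 y + c * (M - f y) - flux G H y by ring.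
  have := derive_le_level y; have := flux_le_level y S0.
  have e : `|c * (M - f y)| = c * u y.
    rewrite normrM gtr0_norm//; congr (_ * _).
    rewrite /u -(ger0_norm (M_extremal y)) normrM.
    by case: s_sign => ->; rewrite ?normrN normr1 mul1r.
  have := ler_normB (f1 y + c * (M - f y)) (flux G H y).
  have := ler_normD (f1 y) (c * (M - f y)).
  rewrite e /Q => h1 h2 h3 h4; lra.
have : Q * u y < X / 2.
  move: hy; rewrite ltr_pdivlMr; last by lra.
  by rewrite /u; lra.
by lra.
Qed.

End extremal_level.

(** The level T with s = 1 is admissible whether or not f comes near it, and already gives |f'| <=
    (a + c) T. *)
Let g_lipschitz x y : `|g x - g y| <= (4 * T ^+ 3 * ((a + c) * T)) * `|x - y|.
Proof.
have dg (z : R) : is_derive z (1 : R) g (4 * f z ^+ 3 * f1 z).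
  by have := df z => ?; apply: is_derive_eq; rewrite /GRing.scale/=; ring.
apply: (@dist_le_of_derive_le_ball _ _ _ y `|x - y| _ x dg) => // z _.
have /andP[fz0 fzT] := f_itv z.
rewrite normrM (@ger0_norm _ (4 * f z ^+ 3)); last by rewrite mulr_ge0 ?exprn_ge0.
have T0T : 0 <= T <= T by rewrite T_ge0 lexx.
have hT x' : 0 <= 1 * (T - f x') by have := f_itv x'; lra.
have := derive_le_level (or_introl erefl) T0T hT z => h.
apply: ler_pM => //; first by rewrite mulr_ge0// exprn_ge0.
- by rewrite ler_wpM2l// lerXn2r ?nnegrE.
- apply: le_trans h _; rewrite ler_wpM2l//; last by lra.
  by rewrite addr_ge0// ltW.
Qed.

Lemma liouville x y : f x = f y.
Proof.
pose D x := f1 x - c * f x - flux G H x.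
(* The derivative of [D] is f'' - c f' minus the source, which the equation makes 0. *)
have D_cst z : D z = D 0.
  apply: is_derive_0_is_cst => {}z.
  have := df z; have := df1 z.
  have := is_derive_flux dG dH pow4_itv g_lipschitz z => ? ? ?.
  by apply: is_derive_eq; rewrite /GRing.scale/= -f_eq; ring.
have ne : range f !=set0 by exists (f 0), 0.
have ubT : has_ubound (range f).
  by exists T => _ [z _ <-]; have /andP[] := f_itv z.
have lb0 : has_lbound (range f).
  by exists 0 => _ [z _ <-]; have /andP[] := f_itv z.
have f_sup z : f z <= sup (range f) by apply: ub_le_sup => //; exists z.
have f_inf z : inf (range f) <= f z by apply: ge_inf => //; exists z.
have /andP[fx0 fxT] := f_itv x.
have sup_itv : 0 <= sup (range f) <= T.
  rewrite (le_trans fx0)//=; apply: ge_sup => // _ [z _ <-].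
  by have /andP[] := f_itv z.
have inf_itv : 0 <= inf (range f) <= T.
  rewrite (le_trans (f_inf x))// andbT; apply: lb_le_inf => // _ [z _ <-].
  by have /andP[] := f_itv z.
have K1 : D 0 = - c * sup (range f).
  apply: (@conserved_at_level 1) => //; first by left.
    by move=> z; rewrite mul1r subr_ge0.
  move=> d d0; have [_ [z _ <-] hz] := sup_adherent d0 (conj ne ubT).
  by exists z; rewrite mul1r; lra.
have K2 : D 0 = - c * inf (range f).
  apply: (@conserved_at_level (-1)) => //; first by right.
    by move=> z; rewrite mulN1r opprB subr_ge0.
  move=> d d0; have [_ [z _ <-] hz] := inf_adherent d0 (conj ne lb0).
  by exists z; rewrite mulN1r; lra.
have eq_si : sup (range f) = inf (range f).
  have c_neq0 : - c != 0 by rewrite oppr_eq0 gt_eqF.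
  by apply: (mulfI c_neq0); rewrite -K1 -K2.
have := f_sup x; have := f_inf x; have := f_sup y; have := f_inf y.
by rewrite eq_si; lra.
Qed.

End liouville.

(** * Constancy of solutions and the oscillation bound *)

Lemma solution_constant (R : realType) (c T : R) (f : R -> R) :
  0 < c -> C2 f ->
  (forall y, ((derive1 (derive1 f) y - c * derive1 f y - f y ^+ 4)%:E = - Econv f y)%E) ->
  (forall y, 0 <= f y <= T) -> forall x y, f x = f y.
Proof.
move=> c0 [df [ddf _]] f_eq f_itv.
have d1 (x : R) : is_derive x (1 : R) f (derive1 f x).
  by split; [exact: df|rewrite derive1E].
have d2 (x : R) : is_derive x (1 : R) (derive1 f) (derive1 (derive1 f) x).
  by split; [exact: ddf|rewrite [RHS]derive1E].
have cf := is_derive_continuous d1.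
have [G dG] := exists_primitive (continuous_exprn_comp (n := 4) cf).
have [H dH] := exists_primitive (is_derive_continuous dG).
apply: (liouville c0 d1 d2 f_itv dG dH) => x.
have g_itv := pow4_itv f_itv.
rewrite (sourceE dG g_itv).
have := f_eq x; rewrite (Econv_mean _ cf dG).
(* The means of f^4 are bounded, so the convolution is finite and the extended-real equation can be
   read in the reals. *)
have i := gauged_integrable (gauged_avg dG g_itv x).
rewrite -(fineK (integrable_fin_num _ i))// => -[] h.
by rewrite /wmean /Rintegral -h; ring.
Qed.

Theorem theorem3p4 (R : realType) (c lam TM : R) :
  0 < c -> 0 < lam -> lam < TM ->
  exists eps0 : R, 0 < eps0 /\
    forall eps : R, eps < eps0 ->
    exists L0 : R, 0 < L0 /\
      forall L : R, L0 < L ->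
      forall f : R -> R,
        C2 f ->
        (forall y, ((derive1 (derive1 f) y - c * derive1 f y - f y ^+ 4)%:E = - Econv f y)%E) ->
        (forall y, lam <= f y <= TM) ->
        (osc f `[(- L)%R, L]%classic < eps%:E)%E ->
        (osc f `[L, +oo[%classic < (3 * eps)%:E)%E.
Proof.
(* Since f is constant, any positive thresholds serve; 1 is taken for both. *)
move=> c0 lam0 _; exists 1; split=> // eps _; exists 1; split=> // L L1 f f_C2 f_eq f_itv.
have f_itv0 y : 0 <= f y <= TM by have := f_itv y; lra.
have f_cst := solution_constant c0 f_C2 f_eq f_itv0.
move=> osc_lt.
(* Positivity of [eps] comes from the oscillation bound: the pair (0, 0) contributes 0 to the
   supremum over [- L, L]. *)
have eps0 : 0 < eps.
  rewrite -lte_fin; apply: le_lt_trans osc_lt; apply: ereal_sup_ubound.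
  exists (0, 0); last by rewrite subrr normr0.
  by split; rewrite /= in_itv/=; lra.
apply: (@le_lt_trans _ _ 0%E); last by rewrite lte_fin; lra.
apply: ge_ereal_sup => _ [[y1 y2] _ <-] /=.
by rewrite (f_cst y1 y2) subrr normr0.
Qed.
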